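(* For all integers $n\geq 2$, $$\det(1;T_0,T_1,\ldots,T_{n-1})=(-1)^{n-1}F_{n-2},$$ and for all integers $n\geq 1$, $$\det(1;T_2,T_3,\ldots,T_{n+1})=(-1)^{n-1}P_{n+2}.$$
   Context: The tribonacci numbers are defined by $T_0=T_1=0$, $T_2=1$, $T_n=T_{n-1}+T_{n-2}+T_{n-3}$ for $n\geq3$. The Fibonacci numbers are $F_0=0$, $F_1=1$, $F_n=F_{n-1}+F_{n-2}$ for $n\ge2$. The Padovan numbers are $P_0=1$, $P_1=P_2=0$, $P_n=P_{n-2}+P_{n-3}$ for $n\geq 3$. For numbers $a_0,a_1,\ldots,a_n$, $\det(a_0;a_1,\ldots,a_n)$ denotes the determinant of the $n\times n$ Toeplitz--Hessenberg matrix whose $(i,j)$ entry is $a_{i-j+1}$ if $i-j+1\ge 0$ and $0$ otherwise (so $a_1$ is on the main diagonal, $a_0$ on the superdiagonal, $a_k$ on the $(k-1)$-th subdiagonal, and all entries above the superdiagonal are $0$). *)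

(* Defs.v *)
From mathcomp Require Import all_boot all_order all_algebra.

Set Implicit Arguments.
Unset Strict Implicit.
Unset Printing Implicit Defensive.

Import GRing.Theory.

Fixpoint tribonacci (n : nat) : nat :=
  match n with
  | 0 | 1 => 0
  | 2 => 1
  | ((n3.+1 as n2).+1 as n1).+1 => tribonacci n1 + tribonacci n2 + tribonacci n3
  end.

Fixpoint fibonacci (n : nat) : nat :=
  match n with
  | 0 => 0
  | 1 => 1
  | (n2.+1 as n1).+1 => fibonacci n1 + fibonacci n2
  end.

Fixpoint padovan (n : nat) : nat :=
  match n with
  | 0 => 1
  | 1 | 2 => 0
  | ((n3.+1 as n2).+1).+1 => padovan n2 + padovan n3
  end.

Local Open Scope ring_scope.

(* The Toeplitz-Hessenberg determinant det(a0; a_1, ..., a_n), where s is the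
   list a_1, ..., a_n.  With 0-based indices i, j the entry is a_(i - j + 1);
   the test j <= i + 1 makes the truncated subtraction exact. *)
Definition th_det (R : comNzRingType) (a0 : R) (s : seq R) : R :=
  \det (\matrix_(i < size s, j < size s)
          if (j <= i.+1)%N then nth 0 (a0 :: s) (i.+1 - j) else 0).

(* Main.v *)
(* The matrix of det(a_0; a_1, ..., a_n) is the lower triangular Toeplitz matrix
   of a_0, ..., a_n with its first row and last column removed, so the
   determinant is, up to sign, the corner entry of the adjugate.  That entry is
   read off the coefficients e_k of 1 / (a_0 + a_1 x + a_2 x^2 + ...).
   Both series below have denominator 1 - x - x^2 - x^3:
     1 + x^3 / (1 - x - x^2 - x^3) has inverse 1 - x^3 / (1 - x - x^2),
     1 + x / (1 - x - x^2 - x^3) has inverse 1 - x / (1 - x^2 - x^3). *)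
Require Import Defs.
From mathcomp Require Import all_boot all_order all_algebra.
From mathcomp Require Import zify ring.
Import GRing.Theory.
Local Open Scope ring_scope.

Lemma th_det_inverse_series (R : comNzRingType) (a e : nat -> R) (n : nat) :
  (forall m, (m <= n)%N ->
     \sum_(k < m.+1) a (m - k)%N * e k = (m == 0%N)%:R) ->
  th_det (a 0%N) [seq a k | k <- iota 1 n] = (-1) ^+ n * a 0%N ^+ n.+1 * e n.
Proof.
move=> ae1.
pose L : 'M[R]_n.+1 :=
  \matrix_(i, j) if (j <= i)%N then a (i - j)%N else 0.
pose v : 'cV[R]_n.+1 := \col_i e i.
have detL : \det L = a 0%N ^+ n.+1.
  rewrite det_trig; last by apply/is_trig_mxP => i j ij; rewrite mxE leqNgt ij.
  rewrite (eq_bigr (fun=> a 0%N)) ?prodr_const ?card_ord // => i _.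
  by rewrite mxE leqnn subnn.
have Lv : L *m v = delta_mx ord0 ord0.
  apply/matrixP => i j; rewrite !mxE (ord1 j) eqxx andbT.
  have := ae1 i (leq_ord i); rewrite (_ : (i == ord0) = (i == 0%N :> nat)) // => <-.
  rewrite (big_ord_widen _ (fun k => a (i - k)%N * e k) (ltn_ord i)).
  rewrite [RHS]big_mkcond; apply: eq_bigr => k _.
  by rewrite !mxE ltnS; case: ifP => // _; rewrite mul0r.
(* Since [L *m v] is the first basis vector, the first column of [\adj L] is [\det L *: v]. *)
have adjL : \adj L ord_max ord0 = a 0%N ^+ n.+1 * e n.
  have /matrixP/(_ ord_max ord0) : \adj L *m (L *m v) = \det L *: v.
    by rewrite mulmxA mul_adj_mx mul_scalar_mx.
  rewrite Lv detL -colE !mxE /=; exact.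
(* The sign of the corner cofactor cancels [(-1) ^+ n], leaving the minor of [L] without row 0 and
   column n. *)
rewrite -mulrA -adjL !mxE /cofactor /= add0n signrMK /th_det.
set s := map _ _; have sz : size s = n by rewrite size_map size_iota.
have nthE k : (k <= n)%N -> nth 0 (a 0%N :: s) k = a k.
  case: k => //= k kn; rewrite (nth_map 0%N) ?size_iota //.
  by rewrite nth_iota // add1n.
move: (size s) sz => m mn; subst m.
congr (\det _); apply/matrixP => i j; rewrite !mxE /= /bump leq0n add1n.
rewrite [(n <= j)%N]leqNgt ltn_ord add0n; case: ifP => // ji.
by apply: nthE; have := ltn_ord i; lia.
Qed.

(** The recurrence makes a(x)(1 - x - x^2 - x^3) a cubic N(x), whose coefficients multiply [e] in
    the second hypothesis; so N(x)e(x) has no terms of degree 4 or more. Hence the convolution obeys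
    the same recurrence from index 4 on, and its zeros at 1, 2, 3 propagate. *)
Lemma tribonacci_convolution (R : comNzRingType) (a e : nat -> R) :
  (forall k, a k.+4 = a k.+3 + a k.+2 + a k.+1) ->
  (forall k, a 0%N * e k.+4 + (a 1%N - a 0%N) * e k.+3
     + (a 2%N - a 1%N - a 0%N) * e k.+2
     + (a 3%N - a 2%N - a 1%N - a 0%N) * e k.+1 = 0) ->
  (forall m, (m < 4)%N ->
     \sum_(k < m.+1) a (m - k)%N * e k = (m == 0%N)%:R) ->
  forall m, \sum_(k < m.+1) a (m - k)%N * e k = (m == 0%N)%:R.
Proof.
move=> arec erec base; elim/ltn_ind => m IH.
case: (ltnP m 4) => [/base // | m4].
have [p mE] : exists p, m = p.+4 by exists (m - 4)%N; lia.
subst m => {m4 base}.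
have c1 := IH p.+1 ltac:(lia); have c2 := IH p.+2 ltac:(lia).
have c3 := IH p.+3 ltac:(lia); have {erec}ep := erec p.
have sub1 q : (q.+1 - q = 1)%N by lia.
have sub2 q : (q.+2 - q = 2)%N by lia.
have sub3 q : (q.+3 - q = 3)%N by lia.
(* Peeling the top terms leaves sums over i <= p, where p + 4 - i >= 4 and the recurrence applies
   termwise. *)
rewrite big_ord_recr /= subnn in c1.
rewrite 2!big_ord_recr /= subnn sub1 in c2.
rewrite 3!big_ord_recr /= subnn sub1 sub2 in c3.
rewrite 4!big_ord_recr /= subnn sub1 sub2 sub3.
have -> : \sum_(i < p.+1) a (p.+4 - i)%N * e i
  = \sum_(i < p.+1) a (p.+3 - i)%N * e i
    + \sum_(i < p.+1) a (p.+2 - i)%N * e i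
    + \sum_(i < p.+1) a (p.+1 - i)%N * e i.
  rewrite -!big_split /=; apply: eq_bigr => i _.
  have ip := leq_ord i.
  rewrite (_ : (p.+4 - i)%N = (p - i).+4); last by lia.
  rewrite (_ : (p.+3 - i)%N = (p - i).+3); last by lia.
  rewrite (_ : (p.+2 - i)%N = (p - i).+2); last by lia.
  rewrite (_ : (p.+1 - i)%N = (p - i).+1); last by lia.
  by rewrite arec !mulrDl.
move: (\sum_(i < p.+1) _) (\sum_(i < p.+1) _) (\sum_(i < p.+1) _) c1 c2 c3.
move=> s3 s2 s1 c1 c2 c3.
(* [ep] accounts exactly for the mismatch of the peeled terms. *)
have := congr2 +%R (congr2 +%R c3 c2) (congr2 +%R c1 ep).
by rewrite !addr0 => <-; ring.
Qed.

Theorem theorem2 :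
  (forall n : nat, (2 <= n)%N ->
     th_det (1 : int) [seq (tribonacci k)%:Z | k <- iota 0 n]
     = (-1) ^+ (n - 1) * (fibonacci (n - 2))%:Z)
  /\
  (forall n : nat, (1 <= n)%N ->
     th_det (1 : int) [seq (tribonacci k)%:Z | k <- iota 2 n]
     = (-1) ^+ (n - 1) * (padovan (n + 2))%:Z).
Proof.
split=> n n_gt.
(* Truncation at small [k] is harmless, as T_0 = F_0 = 0. *)
- pose a k : int := (k == 0%N)%:R + (tribonacci k.-1)%:Z.
  pose e k : int := (k == 0%N)%:R - (fibonacci (k - 2))%:Z.
  have -> : [seq (tribonacci k)%:Z | k <- iota 0 n] = [seq a k | k <- iota 1 n].
    rewrite (iotaDl 1 0) -map_comp; apply: eq_map => k.
    by rewrite /a /= add0r.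
  rewrite [LHS](th_det_inverse_series _ a e); last first.
    move=> m _; apply: tribonacci_convolution m => [k|k|].
    + by case: k => // k; rewrite /a /= !PoszD !add0r.
    (* Here N(x) = 1 - x - x^2: the Fibonacci recurrence. *)
    + by case: k => // k; rewrite /a /e /= !subn2 /= PoszD; ring.
    + by case=> [|[|[|[|m]]]] // _; rewrite !big_ord_recr big_ord0.
  case: n n_gt => [|n] // n_gt.
  by rewrite [a 0%N]/(1 : int) /e /= add0r expr1n subn1 /= exprS; ring.
- pose a k : int := (k == 0%N)%:R + (tribonacci k.+1)%:Z.
  pose e k : int := (k == 0%N)%:R - (padovan (k + 2))%:Z.
  have -> : [seq (tribonacci k)%:Z | k <- iota 2 n] = [seq a k | k <- iota 1 n].
    rewrite (iotaDl 1 1) -map_comp; apply/eq_in_map => k.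
    by rewrite mem_iota /a; case: k => // k _; rewrite /= add0r.
  rewrite [LHS](th_det_inverse_series _ a e); last first.
    move=> m _; apply: tribonacci_convolution m => [k|k|].
    + by rewrite /a /= !PoszD !add0r.
    (* Here N(x) = 1 - x^2 - x^3: the Padovan recurrence. *)
    + by rewrite /a /e !addn2 /= !PoszD; ring.
    + by case=> [|[|[|[|m]]]] // _; rewrite !big_ord_recr big_ord0.
  case: n n_gt => [|n] // n_gt.
  by rewrite [a 0%N]/(1 : int) /e /= add0r expr1n subn1 /= exprS; ring.
Qed.
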